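(* Let $G$ be a group acting on a nonempty set $X$. If the action of $\bigoplus_X \mathbb{Z}/2\mathbb{Z} \rtimes G$ on $\bigoplus_X \mathbb{Z}/2\mathbb{Z}$ is amenable, then so is the action of $G$ on $X$. The converse is not true: there exist a group $G$ and an action of $G$ on a set $X$ that is amenable, but such that the action of $\bigoplus_X \mathbb{Z}/2\mathbb{Z} \rtimes G$ on $\bigoplus_X \mathbb{Z}/2\mathbb{Z}$ is not amenable.
   Context: Groups are discrete. A mean on a set $Y$ is a linear functional $\mu$ on $\ell_\infty(Y)$ that is unital ($\mu(1)=1$) and satisfies $\|\mu\|=1$. An action of a group $H$ on a set $Y$ is amenable if there is an $H$-invariant mean on $Y$. $\bigoplus_X\mathbb{Z}/2\mathbb{Z}$ is the group of finitely supported functions $X\to\mathbb{Z}/2\mathbb{Z}$. It acts on itself by translation, and $G$ acts on it by permuting the basis indexed by $X$; together these give the action of the semidirect product $\bigoplus_X \mathbb{Z}/2\mathbb{Z}\rtimes G$ on $\bigoplus_X\mathbb{Z}/2\mathbb{Z}$: $(a,g)\cdot b=a+g\cdot b$. *)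

(* Defs.v *)
From HB Require Import structures.
From mathcomp Require Import all_boot all_order all_algebra.
From mathcomp Require Import all_classical all_reals all_analysis.

Set Implicit Arguments.
Unset Strict Implicit.
Unset Printing Implicit Defensive.

Import Order.TTheory GRing.Theory Num.Theory.
Import numFieldNormedType.Exports.

Local Open Scope classical_set_scope.
Local Open Scope ring_scope.

(* Left actions of arbitrary (possibly infinite) groups; the actions of
   MathComp's action.v are right actions of finite groups. *)
Record gaction (G : groupType) (Y : Type) := GAction {
  gact :> G -> Y -> Y;
  gact1 : forall y, gact 1%g y = y;
  gactM : forall g h y, gact (g * h)%g y = gact g (gact h y) }.

Section Linfty.
Variables (R : realType) (Y : Type).

Definition linfty_pred : {pred Y -> R} :=
  [pred f : Y -> R | `[< bounded_fun f >]].

Lemma linfty_predP (f : Y -> R) :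
  f \in linfty_pred <-> exists M, forall y, `|f y| <= M.
Proof.
split.
- move=> fb; have bf : bounded_fun f by apply/asboolP; exact: fb.
  by have [M _ fM] := pinfty_ex_gt0 bf; exists M => y; exact: fM.
- move=> [M fM]; apply/asboolP; exists M; split; first exact: num_real.
  by move=> N MN y _; exact: le_trans (fM y) (ltW MN).
Qed.

Record linfty := Linfty {
  linfty_fun :> Y -> R;
  linfty_bounded : linfty_fun \in linfty_pred }.

HB.instance Definition _ := [isSub for linfty_fun].
HB.instance Definition _ := [Choice of linfty by <:].

Lemma linfty_submod : GRing.submod_closed linfty_pred.
Proof.
split.
- by apply/linfty_predP; exists 0 => y; rewrite /= normr0.
- move=> a f g /linfty_predP[M fM] /linfty_predP[N gN].
  apply/linfty_predP; exists (`|a| * M + N) => y.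
  apply: le_trans (ler_normD _ _) _; apply: lerD; last exact: gN.
  by rewrite normrM; apply: ler_wpM2l.
Qed.

HB.instance Definition _ :=
  GRing.isSubmodClosed.Build R (Y -> R) linfty_pred linfty_submod.
HB.instance Definition _ := [SubChoice_isSubLmodule of linfty by <:].

Lemma linfty_one_subproof : (fun=> 1 : R) \in linfty_pred.
Proof. by apply/linfty_predP; exists 1 => y; rewrite normr1. Qed.

Definition linfty_one : linfty := Linfty linfty_one_subproof.

Definition linfty_norm (f : linfty) : R := sup [set `|f y| | y in [set: Y]].

(* The operator norm, a priori infinite. *)
Definition functional_norm (mu : {scalar linfty}) : \bar R :=
  ereal_sup [set `|mu f|%:E | f in [set f | linfty_norm f <= 1]].

Definition is_mean (mu : {scalar linfty}) : Prop :=
  mu linfty_one = 1 /\ functional_norm mu = 1%:E.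

End Linfty.

Section Amenable.
Variables (R : realType) (H : groupType) (Y : Type) (alpha : gaction H Y).

Lemma linfty_translate_subproof (h : H) (f : linfty R Y) :
  (fun y => f (alpha h^-1%g y)) \in @linfty_pred R Y.
Proof.
have /linfty_predP[M fM] := linfty_bounded f.
by apply/linfty_predP; exists M => y; exact: fM.
Qed.

Definition linfty_translate (h : H) (f : linfty R Y) : linfty R Y :=
  Linfty (linfty_translate_subproof h f).

Definition amenable_action : Prop :=
  exists mu : {scalar linfty R Y},
    is_mean mu /\ forall h f, mu (linfty_translate h f) = mu f.

End Amenable.

Section Lamps.
Variable X : Type.

Definition lamps_pred : {pred X -> 'Z_2} :=
  [pred a : X -> 'Z_2 | `[< finite_set [set x | a x != 0] >]].

Lemma lamps_predP (a : X -> 'Z_2) :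
  a \in lamps_pred <-> finite_set [set x | a x != 0].
Proof. by split=> [fa|fa]; apply/asboolP; exact: fa. Qed.

Record lamps := Lamps {
  lamps_fun :> X -> 'Z_2;
  lamps_finite : lamps_fun \in lamps_pred }.

HB.instance Definition _ := [isSub for lamps_fun].
HB.instance Definition _ := [Choice of lamps by <:].

Lemma lamps_zmod : zmod_closed lamps_pred.
Proof.
split.
- by apply/lamps_predP; apply: (sub_finite_set _ (finite_set0 X)) => x /=.
- move=> a b /lamps_predP fa /lamps_predP fb; apply/lamps_predP.
  have fab : finite_set ([set x | a x != 0] `|` [set x | b x != 0]).
    by rewrite finite_setU.
  apply: (sub_finite_set _ fab) => x /= abx.
  case: (eqVneq (a x) 0) => [ax|]; [right|by left].
  apply: contraNneq abx => bx.
  by rewrite [X in X == _](_ : _ = a x - b x) // ax bx subr0.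
Qed.

HB.instance Definition _ :=
  GRing.isZmodClosed.Build (X -> 'Z_2) lamps_pred lamps_zmod.
HB.instance Definition _ := [SubChoice_isSubZmodule of lamps by <:].

End Lamps.

Section Lamplighter.
Variables (G : groupType) (X : Type) (alpha : gaction G X).

Lemma gactK (g : G) : cancel (alpha g) (alpha g^-1%g).
Proof. by move=> x; rewrite -gactM mulVg gact1. Qed.

Lemma gactVK (g : G) : cancel (alpha g^-1%g) (alpha g).
Proof. by move=> x; rewrite -gactM mulgV gact1. Qed.

Lemma lamps_act_subproof (g : G) (a : lamps X) :
  (fun x => a (alpha g^-1%g x)) \in @lamps_pred X.
Proof.
apply/lamps_predP; have /lamps_predP fa := lamps_finite a.
apply: (sub_finite_set _ (finite_image (alpha g) fa)) => x /= ax.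
by exists (alpha g^-1%g x) => //; rewrite gactVK.
Qed.

(* The basis vector at x is sent to the basis vector at g x. *)
Definition lamps_act (g : G) (a : lamps X) : lamps X :=
  Lamps (lamps_act_subproof g a).

Lemma lamps_act1 a : lamps_act 1%g a = a.
Proof. by apply/val_inj/funext => x /=; rewrite invg1 gact1. Qed.

Lemma lamps_actM g h a : lamps_act (g * h)%g a = lamps_act g (lamps_act h a).
Proof. by apply/val_inj/funext => x /=; rewrite invgM gactM. Qed.

Lemma lamps_actD g a b : lamps_act g (a + b) = lamps_act g a + lamps_act g b.
Proof. exact/val_inj. Qed.

Lemma lamps_act0 g : lamps_act g 0 = 0.
Proof. exact/val_inj. Qed.

Lemma lamps_actN g a : lamps_act g (- a) = - lamps_act g a.
Proof. exact/val_inj. Qed.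

End Lamplighter.

(* The unused argument alpha determines the group structure put on this alias
   of the product type below: the semidirect product. *)
Definition lamplighter (G : groupType) (X : Type) (alpha : gaction G X) :
  Type := (lamps X * G)%type.

Section LamplighterGroup.
Variables (G : groupType) (X : Type) (alpha : gaction G X).
Local Notation L := (lamplighter alpha).

HB.instance Definition _ := Choice.copy L (lamps X * G)%type.

Definition lamplighter_one : L := (0, 1%g).
Definition lamplighter_mul (u v : L) : L :=
  (u.1 + lamps_act alpha u.2 v.1, (u.2 * v.2)%g).
Definition lamplighter_inv (u : L) : L :=
  (- lamps_act alpha u.2^-1%g u.1, u.2^-1%g).

Lemma lamplighter_mulA : associative lamplighter_mul.
Proof.
move=> u v w; congr pair; last exact: mulgA.
by rewrite /= lamps_actD lamps_actM addrA.
Qed.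

Lemma lamplighter_mul1 : left_id lamplighter_one lamplighter_mul.
Proof.
by move=> [a g]; congr pair; rewrite /= ?mul1g // lamps_act1 add0r.
Qed.

Lemma lamplighter_mulr1 : right_id lamplighter_one lamplighter_mul.
Proof.
by move=> [a g]; congr pair; rewrite /= ?mulg1 // lamps_act0 addr0.
Qed.

Lemma lamplighter_mulV :
  left_inverse lamplighter_one lamplighter_inv lamplighter_mul.
Proof.
by move=> [a g]; congr pair; rewrite /= ?mulVg // addNr.
Qed.

Lemma lamplighter_mulrV :
  right_inverse lamplighter_one lamplighter_inv lamplighter_mul.
Proof.
move=> [a g]; congr pair; rewrite /= ?mulgV //.
by rewrite lamps_actN -lamps_actM mulgV lamps_act1 subrr.
Qed.

HB.instance Definition _ := isGroup.Build L
  lamplighter_mulA lamplighter_mul1 lamplighter_mulr1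
  lamplighter_mulV lamplighter_mulrV.

Definition lamplighter_fun (u : L) (b : lamps X) : lamps X :=
  u.1 + lamps_act alpha u.2 b.

Lemma lamplighter_fun1 b : lamplighter_fun 1%g b = b.
Proof. by rewrite /lamplighter_fun /= lamps_act1 add0r. Qed.

Lemma lamplighter_funM u v b :
  lamplighter_fun (u * v)%g b = lamplighter_fun u (lamplighter_fun v b).
Proof.
by rewrite /lamplighter_fun /= lamps_actD lamps_actM addrA.
Qed.

Definition lamplighter_action : gaction L (lamps X) :=
  GAction lamplighter_fun1 lamplighter_funM.

End LamplighterGroup.

(* Main.v *)
Require Import Defs.
From HB Require Import structures.
From mathcomp Require Import all_boot all_order all_algebra.
From mathcomp Require Import all_classical all_reals all_analysis.
From mathcomp Require Import lra.

(** Let i : Y -> X be an injective G-equivariant map with Y nonempty. If the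
    lamplighter action over X has an invariant mean mu, then G has an
    invariant mean on Y ([amenable_restriction]). Indeed a function f on Y
    gives a function on lamp configurations, sending a configuration to the
    average of f over the finite set of points y whose lamp i y is lit. This
    construction is linear, positive and G-equivariant, so integrating against
    mu gives an invariant positive functional on l_infty(Y). The only obstacle
    is that the constant 1 is sent to the indicator of the configurations with
    some lamp lit on i(Y), so the functional has to be divided by the mass of
    these. That mass is at least 1/2: switching one lamp of i(Y) moves the
    complementary set to a disjoint set of the same mass
    ([mean_unlit_le]). The case i = id is the first half of the theorem.

    For the second half, let G act on Y without invariant mean and adjoin a
    fixed point to Y. Evaluation at the fixed point is an invariant mean, but
    by the above applied to the inclusion of Y, the lamplighter action over
    the enlarged set is not amenable. For G one can take the group of all
    bijections of the countable set Y = option bool * nat. Its three columns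
    are exchanged by bijections, hence have the same mass m; one column is
    also exchanged with the union of the two others, so m = 2 m. Then m = 0,
    which is absurd since the total mass 3 m is 1
    ([bijection_action_not_amenable]). *)

Set Implicit Arguments.
Unset Strict Implicit.
Unset Printing Implicit Defensive.

Import Order.TTheory GRing.Theory Num.Theory.
Import numFieldNormedType.Exports.

Local Open Scope classical_set_scope.
Local Open Scope ring_scope.

(** * Means as positive unital functionals *)

Section Means.
Variables (R : realType) (Y : Type).
Implicit Types (f : linfty R Y) (mu : {scalar linfty R Y}).

Lemma le_linfty_norm f y : `|f y| <= linfty_norm f.
Proof.
apply: ub_le_sup; last by exists y.
have /linfty_predP[M fM] := linfty_bounded f.
by exists M => _ [z _ <-].
Qed.

Lemma linfty_norm_empty f : ~ inhabited Y -> linfty_norm f = 0.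
Proof.
move=> Y0; rewrite /linfty_norm (_ : [set _ | _ in _] = set0) ?sup0 //.
by apply/seteqP; split=> // r [y _ _]; case: Y0.
Qed.

Lemma linfty_norm_le f (M : R) :
  0 <= M -> (forall y, `|f y| <= M) -> linfty_norm f <= M.
Proof.
move=> M0 fM; have [[y]|Y0] := pselect (inhabited Y).
  by apply: ge_sup; [exists `|f y|, y|move=> _ [z _ <-]].
by rewrite linfty_norm_empty.
Qed.

Lemma mean_le1 mu f : is_mean mu -> (forall y, `|f y| <= 1) -> `|mu f| <= 1.
Proof.
move=> [_ mu_norm] f1; rewrite -lee_fin -mu_norm; apply: ereal_sup_ubound.
by exists f => //; exact: linfty_norm_le.
Qed.

(** With 0 <= f <= M, the function 1 - f / M lies in the unit ball, so its
    image 1 - mu f / M is at most 1. *)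
Lemma mean_ge0 mu f : is_mean mu -> (forall y, 0 <= f y) -> 0 <= mu f.
Proof.
move=> mu_mean f0; pose M := linfty_norm f + 1.
have fM y : f y <= M.
  rewrite /M -[f y]ger0_norm //; apply: le_trans (le_linfty_norm f y) _.
  by rewrite lerDl.
have M0 : 0 < M.
  apply: ltr_wpDl ltr01; have [[y]|Y0] := pselect (inhabited Y).
    exact: le_trans (normr_ge0 _) (le_linfty_norm f y).
  by rewrite linfty_norm_empty.
have : `|mu (linfty_one R Y - M^-1 *: f)| <= 1.
  apply: mean_le1 => // y.
  change (`|1 - M^-1 * f y| <= 1).
  have : 0 <= M^-1 * f y by apply: mulr_ge0 => //; rewrite invr_ge0 ltW.
  have : M^-1 * f y <= 1 by rewrite ler_pdivrMl ?mulr1.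
  by rewrite ler_norml; lra.
rewrite linearB linearZ /= mu_mean.1 => /(le_trans (ler_norm _)).
by rewrite gerBl pmulr_rge0 ?invr_gt0.
Qed.

(** If -1 <= f <= 1, then 1 - f and 1 + f are nonnegative, which bounds
    mu f by mu 1 = 1 on both sides. *)
Lemma ge0_is_mean mu :
  (forall f, (forall y, 0 <= f y) -> 0 <= mu f) ->
  mu (linfty_one R Y) = 1 -> is_mean mu.
Proof.
move=> mu0 mu1; split=> //; apply/eqP; rewrite eq_le; apply/andP; split.
  apply: ge_ereal_sup => _ [f /= f1 <-]; rewrite lee_fin ler_norml.
  have fy y : -1 <= f y <= 1.
    by rewrite -ler_norml; exact: le_trans (le_linfty_norm f y) f1.
  have : 0 <= mu (linfty_one R Y - f).
    by apply: mu0 => y; change (0 <= 1 - f y); have := fy y; lra.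
  have : 0 <= mu (linfty_one R Y + f).
    by apply: mu0 => y; change (0 <= 1 + f y); have := fy y; lra.
  by rewrite linearB linearD /= mu1; lra.
apply: ereal_sup_ubound; exists (linfty_one R Y); last by rewrite mu1 normr1.
by apply: linfty_norm_le => // y; rewrite /= normr1.
Qed.

(** Every mean below is first given as a plain function; this packages it as
    a linear form. *)
Lemma mean_of_positive (phi : linfty R Y -> R) :
  scalar phi -> (forall f, (forall y, 0 <= f y) -> 0 <= phi f) ->
  phi (linfty_one R Y) = 1 ->
  exists2 mu : {scalar linfty R Y}, is_mean mu & mu =1 phi.
Proof.
move=> phi_lin phi0 phi1.
pose phiL := GRing.isLinear.Build R (linfty R Y) R *%R phi phi_lin.
pose mu : {scalar linfty R Y} := HB.pack phi phiL.
by exists mu => //; exact: ge0_is_mean.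
Qed.

Lemma linfty_indic_subproof (A : set Y) : (\1_A : Y -> R) \in @linfty_pred R Y.
Proof.
by apply/linfty_predP; exists 1 => y; rewrite indicE; case: (_ \in _);
  rewrite ?normr0 ?normr1.
Qed.

Definition linfty_indic (A : set Y) : linfty R Y :=
  Linfty (linfty_indic_subproof A).

Lemma linfty_indicU (A B : set Y) : A `&` B = set0 ->
  linfty_indic (A `|` B) = linfty_indic A + linfty_indic B.
Proof.
move=> AB0; apply/val_inj/funext => y.
change (\1_(A `|` B) y = \1_A y + \1_B y :> R).
have AB : ~ (A y /\ B y) by move=> AB; have : set0 y by rewrite -AB0.
rewrite !indicE in_setU.
case: (boolP (y \in A)) => [/set_mem Ay|_]; last by rewrite add0r.
by case: (boolP (y \in B)) => [/set_mem By|_]; [case: AB|rewrite addr0].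
Qed.

End Means.

(** * Averaging over finite sets *)

Section Average.
Variables (R : realType) (Y : choiceType).
Implicit Types (S : set Y) (f : Y -> R).

(** The denominator is the cardinal of S. For empty S, the value is
    0 / 0 = 0. *)
Definition average S f : R := (\sum_(y \in S) f y) / (\sum_(y \in S) (1 : R)).

Lemma average_set0 f : average set0 f = 0.
Proof. by rewrite /average !fsbig_set0 mul0r. Qed.

Lemma average1 S : finite_set S -> S !=set0 -> average S (fun=> 1) = 1.
Proof.
move=> finS [y Sy]; rewrite /average divff //; apply/eqP => S0.
have /eqP := pfsumr_eq0 finS (fun z _ => ler01 : 0 <= (1 : R)) S0 Sy.
by rewrite oner_eq0.
Qed.

Lemma average_linear S : finite_set S -> scalar (average S).
Proof.
move=> finS a f g; rewrite /average /GRing.scale /= mulrA mulr_fsumr -mulrDl.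
by rewrite -fsbig_split.
Qed.

Lemma average_ge0 S f : (forall y, 0 <= f y) -> 0 <= average S f.
Proof. by move=> f0; apply: divr_ge0; exact: fsumr_ge0. Qed.

Lemma average_le S f (M : R) : finite_set S -> 0 <= M ->
  (forall y, `|f y| <= M) -> `|average S f| <= M.
Proof.
move=> finS M0 fM; rewrite /average.
have [->|S0] := eqVneq (\sum_(y \in S) (1 : R)) 0.
  by rewrite invr0 mulr0 normr0.
have S_ge0 : 0 <= \sum_(y \in S) (1 : R) by exact: fsumr_ge0.
rewrite normrM normfV (ger0_norm S_ge0) ler_pdivrMr ?lt_def ?S0 //.
rewrite mulr_fsumr !fsbig_finite //=; apply: le_trans (ler_norm_sum _ _ _) _.
by apply: ler_sum => y _; rewrite mulr1.
Qed.

Lemma average_image (h : Y -> Y) S f :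
  injective h -> average (h @` S) f = average S (f \o h).
Proof.
move=> h_inj; have hS : set_inj S h by move=> x y _ _ /h_inj.
by rewrite /average !(fsbig_image S h).
Qed.

End Average.

(** * From lamp configurations to points *)

Section Restriction.
Variables (R : realType) (G : groupType) (X : Type) (Y : choiceType).
Variables (alpha : gaction G X) (beta : gaction G Y) (i : Y -> X).
Hypothesis i_inj : injective i.
Hypothesis i_equiv : forall g y, i (beta g y) = alpha g (i y).

Definition lit (a : lamps X) : set Y := [set y | a (i y) != 0].

Lemma finite_lit a : finite_set (lit a).
Proof.
apply: (@finite_preimage _ _ [set x | a x != 0] i).
  by move=> y z _ _ /i_inj.
exact/lamps_predP/lamps_finite.
Qed.

Lemma lamplighter_action_permV (g : G) (a : lamps X) :
  lamplighter_action alpha ((0, g) : lamplighter alpha)^-1%g a =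
  lamps_act alpha g^-1%g a.
Proof.
change (- lamps_act alpha g^-1%g 0 + lamps_act alpha g^-1%g a =
  lamps_act alpha g^-1%g a).
by rewrite lamps_act0 oppr0 add0r.
Qed.

Lemma lit_act g a : lit (lamps_act alpha g a) = beta g @` lit a.
Proof.
apply/seteqP; split=> y; rewrite /lit /=.
  by exists (beta g^-1%g y); [rewrite i_equiv|rewrite gactVK].
by case=> z az <-; rewrite i_equiv gactK.
Qed.

Lemma lit_average_subproof (f : linfty R Y) :
  (fun a => average (lit a) f) \in @linfty_pred R (lamps X).
Proof.
apply/linfty_predP; exists (linfty_norm f) => a.
apply: average_le => [||y]; [exact: finite_lit| |exact: le_linfty_norm].
have [[y]|Y0] := pselect (inhabited Y).
  exact: le_trans (normr_ge0 _) (le_linfty_norm f y).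
by rewrite linfty_norm_empty.
Qed.

Definition lit_average (f : linfty R Y) : linfty R (lamps X) :=
  Linfty (lit_average_subproof f).

(** The translations of Y by g correspond to the elements (0, g) of the
    lamplighter group, which carry lit lamps to lit lamps. *)
Lemma lit_average_translate g f :
  lit_average (linfty_translate beta g f) =
  linfty_translate (lamplighter_action alpha) ((0, g) : lamplighter alpha)
    (lit_average f).
Proof.
apply/val_inj/funext => a.
change (average (lit a) (linfty_translate beta g f) = average
  (lit (lamplighter_action alpha ((0, g) : lamplighter alpha)^-1%g a)) f).
rewrite lamplighter_action_permV lit_act average_image //.
exact: can_inj (gactK beta _).
Qed.

Definition lamp_at_fun (x z : X) : 'Z_2 := if `[< z = x >] then 1 else 0.

Lemma lamp_at_subproof (x : X) : lamp_at_fun x \in @lamps_pred X.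
Proof.
apply/lamps_predP; apply: (sub_finite_set _ (finite_set1 x)) => z /=.
by rewrite /lamp_at_fun; case: asboolP => // _; rewrite eqxx.
Qed.

Definition lamp_at x : lamps X := Lamps (lamp_at_subproof x).

Definition unlit : set (lamps X) := [set a | lit a = set0].

(** Switching the lamp at i y0 moves [unlit] to a set disjoint from it, of the
    same mass; the two masses add up to at most 1. *)
Lemma mean_unlit_le (mu : {scalar linfty R (lamps X)}) : inhabited Y ->
  is_mean mu ->
  (forall u f, mu (linfty_translate (lamplighter_action alpha) u f) = mu f) ->
  mu (linfty_indic R unlit) <= 2^-1.
Proof.
move=> [y0] mu_mean mu_inv.
pose u : lamplighter alpha := (lamp_at (i y0), 1%g).
have disj a : unlit a ->
    ~ unlit (lamplighter_action alpha u^-1%g a).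
  move=> a0.
  change (~ unlit (- lamps_act alpha 1^-1%g (lamp_at (i y0)) +
    lamps_act alpha 1^-1%g a)).
  rewrite invg1 !lamps_act1 => ua.
  have ay0 : a (i y0) = 0.
    apply/eqP/negPn/negP => ay.
    by have : lit a y0 by []; rewrite a0.
  suff : lit (- lamp_at (i y0) + a) y0 by rewrite ua.
  change (- lamp_at_fun (i y0) (i y0) + a (i y0) != 0).
  by rewrite ay0 addr0 /lamp_at_fun; case: asboolP.
have indic_le v w : (unlit v -> ~ unlit w) ->
    0 <= 1 - \1_unlit v - \1_unlit w :> R.
  rewrite !indicE; case: (boolP (v \in unlit)) => [/set_mem v0 /(_ v0)|_ _].
    by move=> w0; rewrite (memNset w0) subr0 subrr.
  by case: (_ \in _); rewrite ?subr0 ?subrr.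
have : 0 <= mu (linfty_one R (lamps X) - linfty_indic R unlit -
    linfty_translate (lamplighter_action alpha) u (linfty_indic R unlit)).
  by apply: mean_ge0 => // a; exact: indic_le (disj a).
by rewrite 2!raddfB /= mu_inv mu_mean.1; lra.
Qed.

Lemma lit_average1 :
  lit_average (linfty_one R Y) = linfty_one R (lamps X) - linfty_indic R unlit.
Proof.
apply/val_inj/funext => a.
change (average (lit a) (fun=> 1) = 1 - \1_unlit a :> R).
rewrite indicE; case: (boolP (a \in unlit)) => [/set_mem ->|a0].
  by rewrite average_set0 subrr.
rewrite subr0 average1 //; first exact: finite_lit.
by apply/set0P; apply: contraNneq a0 => a0; exact/mem_set.
Qed.

Lemma lit_average_linear : linear lit_average.
Proof.
move=> c f g; apply/val_inj/funext => a.
exact: average_linear (finite_lit a) _ _ _.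
Qed.

Lemma amenable_restriction_choice : inhabited Y ->
  amenable_action R (lamplighter_action alpha) -> amenable_action R beta.
Proof.
move=> Y0 [mu [mu_mean mu_inv]].
pose p := mu (linfty_indic R unlit).
have p_lt1 : 0 < 1 - p.
  by have := mean_unlit_le Y0 mu_mean mu_inv; rewrite -/p; lra.
pose phi f := mu (lit_average f) / (1 - p).
have [|f f0||nu nu_mean nuE] := @mean_of_positive R Y phi.
- by move=> c f g; rewrite /phi lit_average_linear linearP /= mulrDl mulrA.
- apply: divr_ge0 (ltW p_lt1); apply: mean_ge0 => // a.
  exact: average_ge0.
- by rewrite /phi lit_average1 linearB /= mu_mean.1 divff // gt_eqF.
by exists nu; split=> // g f; rewrite !nuE /phi lit_average_translate mu_inv.
Qed.

End Restriction.

(** The averages use a choice operator on Y, which exists classically. *)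
Lemma amenable_restriction (R : realType) (G : groupType) (X Y : Type)
    (alpha : gaction G X) (beta : gaction G Y) (i : Y -> X) :
  injective i -> (forall g y, i (beta g y) = alpha g (i y)) -> inhabited Y ->
  amenable_action R (lamplighter_action alpha) -> amenable_action R beta.
Proof.
elim/Pchoice: Y => Y in beta i *; exact: amenable_restriction_choice.
Qed.

(** * Adjoining a fixed point *)

Section FixedPoint.
Variables (R : realType) (G : groupType) (Y : Type) (beta : gaction G Y).

Lemma option_gact1 (y : option Y) : omap (beta 1%g) y = y.
Proof. by case: y => //= y; rewrite gact1. Qed.

Lemma option_gactM g h (y : option Y) :
  omap (beta (g * h)%g) y = omap (beta g) (omap (beta h) y).
Proof. by case: y => //= y; rewrite gactM. Qed.

Definition option_gaction : gaction G (option Y) :=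
  @GAction G (option Y) (fun g => omap (beta g)) option_gact1 option_gactM.

Lemma option_gaction_amenable : amenable_action R option_gaction.
Proof.
have [//|//|//|mu mu_mean muE] :=
  @mean_of_positive R (option Y) (fun f => f None).
by exists mu; split=> // h f; rewrite !muE.
Qed.

End FixedPoint.

(** * A symmetric group without invariant mean *)

Section SymmetricGroup.
Variable T : Type.

Record bijection := Bijection {
  bij_fun :> T -> T;
  bij_inv : T -> T;
  bij_funK : cancel bij_fun bij_inv;
  bij_invK : cancel bij_inv bij_fun }.

HB.instance Definition _ := gen_eqMixin bijection.
HB.instance Definition _ := gen_choiceMixin bijection.

Lemma bijectionP (s t : bijection) : s =1 t -> s = t.
Proof.
case: s t => [f f' fK f'K] [g g' gK g'K] /= /funext fg; subst g.
have f'g' : f' = g' by apply/funext => x; rewrite -{1}[x]g'K fK.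
by subst g'; congr Bijection; exact: Prop_irrelevance.
Qed.

Definition bij_one : bijection := @Bijection id id (fun=> erefl) (fun=> erefl).
Definition bij_mul (s t : bijection) : bijection :=
  Bijection (can_comp (bij_funK s) (bij_funK t))
            (can_comp (bij_invK t) (bij_invK s)).
Definition bij_inverse (s : bijection) : bijection :=
  Bijection (bij_invK s) (bij_funK s).

Lemma bij_mulA : associative bij_mul.
Proof. by move=> s t u; exact: bijectionP. Qed.
Lemma bij_mul1 : left_id bij_one bij_mul.
Proof. by move=> s; exact: bijectionP. Qed.
Lemma bij_mulr1 : right_id bij_one bij_mul.
Proof. by move=> s; exact: bijectionP. Qed.
Lemma bij_mulV : left_inverse bij_one bij_inverse bij_mul.
Proof. by move=> s; apply: bijectionP => x /=; rewrite bij_funK. Qed.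
Lemma bij_mulrV : right_inverse bij_one bij_inverse bij_mul.
Proof. by move=> s; apply: bijectionP => x /=; rewrite bij_invK. Qed.

HB.instance Definition _ := isGroup.Build bijection
  bij_mulA bij_mul1 bij_mulr1 bij_mulV bij_mulrV.

Definition bijection_action : gaction bijection T :=
  @GAction bijection T bij_fun (fun=> erefl) (fun _ _ _ => erefl).

Definition involution (f : T -> T) (fK : involutive f) : bijection :=
  Bijection fK fK.

End SymmetricGroup.

Section NoInvariantMean.
Variable R : realType.
Let Y : Type := (option bool * nat)%type.

Definition column (c : option bool) : set Y := [set y | y.1 = c].

Definition swap_column (b : bool) (y : Y) : Y :=
  (if y.1 is Some c then if c == b then None else Some c else Some b, y.2).

Lemma swap_columnK b : involutive (swap_column b).
Proof. by case: b; case=> [[[]|] n]. Qed.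

(** Exchanges the column [None] with the union of the two others, its even
    half with the column [Some false] and its odd half with [Some true]. *)
Definition interleave (y : Y) : Y :=
  if y.1 is Some b then (None, (b + y.2.*2)%N) else (Some (odd y.2), y.2./2).

Lemma interleaveK : involutive interleave.
Proof.
case=> [[b|] n]; rewrite /interleave /=; last by rewrite odd_double_half.
by rewrite oddD odd_double addbF oddb half_bit_double.
Qed.

(** The involutions [swap_column] force all columns to have the same mass m,
    and [interleave] forces m = m + m, so the total mass cannot be 1. *)
Lemma bijection_action_not_amenable : ~ amenable_action R (bijection_action Y).
Proof.
move=> [mu [mu_mean mu_inv]].
pose m A := mu (linfty_indic R A).
have m_inv (f : Y -> Y) (fK : involutive f) A : m (f @^-1` A) = m A.
  rewrite /m -[RHS](mu_inv (involution fK)); congr (mu _).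
  by apply/val_inj/funext.
have mU A B : A `&` B = set0 -> m (A `|` B) = m A + m B.
  by move=> AB; rewrite /m linfty_indicU // linearD.
have m_swap b : m (column (Some b)) = m (column None).
  rewrite -(m_inv _ (swap_columnK b)); congr m.
  by apply/seteqP; split; case: b => -[[[]|] n].
have m_some : m (column (Some true) `|` column (Some false)) =
    m (column None) + m (column None).
  rewrite mU ?m_swap //.
  by apply/seteqP; split=> // -[c n]; rewrite /column /= => -[->].
have m_double : m (column None) = m (column None) + m (column None).
  rewrite -[LHS](m_inv _ interleaveK) -m_some; congr m.
  apply/seteqP; split=> -[[b|] n] //=; last by case.
  by case: b; [left|right].
have m_total : 1 = m (column None) + (m (column None) + m (column None)).
  rewrite -m_some -mU; last first.
    by apply/seteqP; split=> // -[c n]; rewrite /column /= => -[-> []].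
  rewrite -mu_mean.1; congr (mu _); apply/val_inj/funext => y.
  change (1 = \1_(column None `|`
    (column (Some true) `|` column (Some false))) y :> R).
  rewrite indicE mem_set //; case: y => [[[]|] n].
  - by right; left.
  - by right; right.
  - by left.
by move: m_double m_total; lra.
Qed.

End NoInvariantMean.

Theorem proposition3p1 (R : realType) :
  (forall (G : groupType) (X : Type) (alpha : gaction G X),
     inhabited X ->
     amenable_action R (lamplighter_action alpha) -> amenable_action R alpha)
  /\
  (exists (G : groupType) (X : Type) (alpha : gaction G X),
     amenable_action R alpha /\
     ~ amenable_action R (lamplighter_action alpha)).
Proof.
split=> [G X alpha|].
  exact: (@amenable_restriction R G X X alpha alpha id).
pose beta := bijection_action (option bool * nat)%type.
exists (bijection (option bool * nat)%type), _, (option_gaction beta).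
split; first exact: option_gaction_amenable.
move=> amen; apply: (@bijection_action_not_amenable R).
apply: (@amenable_restriction R _ _ _ (option_gaction beta) beta Some) amen.
- by move=> y z [].
- by [].
- exact: inhabits (None, 0%N).
Qed.
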